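(* For each probability measure $\mu$ on $(\Omega,\mathcal{F})$, the following statements are equivalent: (a) $\mu$ is trivial on the tail $\sigma$-algebra $\mathcal{F}_{-\infty}=\bigcap_{k\in\mathbb{Z}}\mathcal{F}_{\le k}$. (b) $\displaystyle\lim_{\Lambda\uparrow\mathbb{Z}}\ \sup_{B\in\mathcal{F}_{\Lambda_-}}|\mu(A\cap B)-\mu(A)\mu(B)|=0$ for all cylinder sets $A\in\mathcal{F}$. (c) $\displaystyle\lim_{\Lambda\uparrow\mathbb{Z}}\ \sup_{B\in\mathcal{F}_{\Lambda_-}}|\mu(A\cap B)-\mu(A)\mu(B)|=0$ for all $A\in\mathcal{F}$.
   Context: Let $(E,\mathcal{E})$ be a measurable space and $\Omega\subset E^{\mathbb{Z}}$ a set of (admissible) configurations, endowed with the $\sigma$-algebra $\mathcal{F}$ which is the restriction to $\Omega$ of the product $\sigma$-algebra. For $\Lambda\subset\mathbb{Z}$, $\mathcal{F}_\Lambda\subset\mathcal{F}$ is the $\sigma$-algebra generated by the coordinates $\omega\mapsto\omega_i$, $i\in\Lambda$; $\mathcal{F}_{\le n}=\mathcal{F}_{]-\infty,n]}$. $\mathcal{S}_b$ is the set of (nonempty) finite intervals of $\mathbb{Z}$; for $\Lambda\in\mathcal{S}_b$, $\Lambda_-=\,]-\infty,\min\Lambda-1]$. A cylinder set is a set belonging to $\mathcal{F}_\Delta$ for some $\Delta\in\mathcal{S}_b$. The limit $\lim_{\Lambda\uparrow\mathbb{Z}}$ is the limit along the net of all $\Lambda\in\mathcal{S}_b$ directed by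 inclusion. A measure is trivial on a $\sigma$-algebra if it gives each of its sets measure $0$ or $1$. *)

(* Defs.v *)
From HB Require Import structures.
From mathcomp Require Import all_boot all_order all_algebra.
From mathcomp Require Import all_classical all_reals all_analysis.

Set Implicit Arguments.
Unset Strict Implicit.
Unset Printing Implicit Defensive.
Import Order.TTheory GRing.Theory Num.Theory.
Import numFieldNormedType.Exports.
Local Open Scope classical_set_scope.
Local Open Scope ring_scope.

(* Counterpart of the library's [g_sigma_preimage], which is limited to finite
   families indexed by ['I_n]. *)
Definition g_sigma_family d (E : measurableType d) (T : Type)
    (L : set int) (f : int -> T -> E) : set (set T) :=
  <<s \bigcup_(i in L) preimage_set_system setT (f i) measurable >>.

Definition product_sigma_algebra d (E : measurableType d) :
    set (set (int -> E)) :=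
  g_sigma_family setT (fun i (w : int -> E) => w i).

(* A [measurableType] is pointed, whence the nonemptiness argument; it is
   implied by the existence of a probability measure on the space. *)
Definition config d (E : measurableType d) (Omega : set (int -> E))
  (Omega0 : Omega !=set0) : Type := Omega.

Definition config_display d (E : measurableType d) (Omega : set (int -> E)) :
  Omega !=set0 -> measure_display.
Proof. exact: (fun _ => d). Qed.

Section config_measurable.
Context d (E : measurableType d) (Omega : set (int -> E)).
Variable Omega0 : Omega !=set0.
Local Notation config := (config Omega0).

HB.instance Definition _ := gen_eqMixin config.
HB.instance Definition _ := gen_choiceMixin config.
HB.instance Definition _ := isPointed.Build config
  (exist _ (projT1 (cid Omega0)) (mem_set (projT2 (cid Omega0)))).

(* The trace on Omega, seen on the subtype: {sval @^-1` B | B measurable}. *)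
Definition config_sigma_algebra : set (set config) :=
  preimage_set_system setT (fun w : config => sval w) (@product_sigma_algebra d E).

Let config_sigma_algebraP : sigma_algebra setT config_sigma_algebra.
Proof. exact/sigma_algebra_preimage/smallest_sigma_algebra. Qed.

Let config_set0 : config_sigma_algebra set0.
Proof. by case: config_sigma_algebraP. Qed.

Let config_setC A : config_sigma_algebra A -> config_sigma_algebra (~` A).
Proof. by case: config_sigma_algebraP => _ + _ => /[apply]; rewrite setTD. Qed.

Let config_bigcup (F : (set config)^nat) :
  (forall i, config_sigma_algebra (F i)) ->
  config_sigma_algebra (\bigcup_i F i).
Proof. by case: config_sigma_algebraP => _ _; exact. Qed.

HB.instance Definition _ := @isMeasurable.Build (config_display Omega0) config
  config_sigma_algebra config_set0 config_setC config_bigcup.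

Definition coord (i : int) (w : config) : E := sval w i.

Definition coord_sigma_algebra (L : set int) : set (set config) :=
  g_sigma_family L coord.

Definition tail_sigma_algebra : set (set config) :=
  \bigcap_(k in [set: int]) coord_sigma_algebra `]-oo, k].

Lemma coord_sigma_algebra_measurable (L : set int) :
  coord_sigma_algebra L `<=` measurable.
Proof.
apply: smallest_sub; first exact: config_sigma_algebraP.
move=> _ [i _ [B mB <-]]; exists ((fun w : int -> E => w i) @^-1` B) => //.
apply: sub_sigma_algebra; exists i => //; exists B => //.
by rewrite setTI.
Qed.

End config_measurable.
Arguments tail_sigma_algebra {d E Omega} Omega0 _.

(* A nonempty finite interval [a, b] of Z is encoded by the pair (a, b) of its
   endpoints, with a <= b; in particular its minimum is a. *)
Definition finite_itv : set (int * int) := [set p | p.1 <= p.2].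

Definition itv_set (p : int * int) : set int := `[p.1, p.2].

Definition itv_past (p : int * int) : set int := `]-oo, p.1 - 1].

(* The section filter of the net of finite intervals directed by inclusion. *)
Definition itv_net : set_system (int * int) :=
  filter_from finite_itv
    (fun p => [set q | finite_itv q /\ itv_set p `<=` itv_set q]).

Global Instance itv_net_proper : ProperFilter itv_net.
Proof.
apply: filter_from_proper; last by move=> p Fp; exists p; split.
apply: filter_from_filter; first by exists (0, 0); rewrite /finite_itv /=.
move=> p q Fp Fq; exists (Order.min p.1 q.1, Order.max p.2 q.2).
  by rewrite /finite_itv /= ge_min le_max Fp.
move=> r [Fr pqr]; split; split => // i /=; rewrite /itv_set /= in_itv /=.
- move=> /andP[pi ip]; apply: pqr.
  by rewrite /itv_set /= in_itv /= ge_min le_max pi ip.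
- move=> /andP[qi iq]; apply: pqr.
  by rewrite /itv_set /= in_itv /= ge_min le_max qi iq !orbT.
Qed.

Section config_measure.
Context d (E : measurableType d) (Omega : set (int -> E)).
Variable Omega0 : Omega !=set0.
Local Notation config := (config Omega0).

Definition cylinder_set (A : set config) : Prop :=
  exists2 p, finite_itv p & coord_sigma_algebra (itv_set p) A.

Context (R : realType) (mu : probability config R).

Definition trivial_on (G : set (set config)) : Prop :=
  forall A, G A -> mu A = 0%E \/ mu A = 1%E.

Local Open Scope ereal_scope.

Definition past_dependence (A : set config) (p : int * int) : \bar R :=
  ereal_sup [set `|mu (A `&` B) - mu A * mu B|
            | B in coord_sigma_algebra (itv_past p)].

End config_measure.

(* Main.v *)
Require Import Defs.
From mathcomp Require Import all_boot all_order all_algebra.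
From mathcomp Require Import all_classical all_reals all_analysis.
From mathcomp Require Import zify ring lra.

Set Implicit Arguments.
Unset Strict Implicit.
Unset Printing Implicit Defensive.
Import Order.TTheory GRing.Theory Num.Theory.
Import numFieldNormedType.Exports.
Local Open Scope classical_set_scope.
Local Open Scope ereal_scope.

(** The quantity |mu (A `&` B) - mu A * mu B| is the absolute covariance of the
    indicators of A and B.  For a fixed A, B |-> cov A B is a bounded signed
    measure vanishing on the whole space, and past_dependence measures its size
    on the sigma-algebra of a past ]-oo, k].  Since the pasts shrink as k
    decreases, the limit along finite intervals is a limit along the sequence
    of pasts G n, generated by the coordinates in ]-oo, -n]
    (past_dependence_cvg0P); the tail is the intersection of the G n.

    If mu is trivial on the tail, every measurable A decouples from the far
    past.  This is usually deduced from backward martingale convergence of the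
    conditional probabilities of A; the argument below is a direct one in the
    style of the Hahn decomposition (asymp_indep_of_trivial_tail).  If A did
    not decouple, each G n would contain an event of covariance at least some
    e > 0 with A, hence an event B n that nearly maximizes B |-> cov A B on
    G n, with an error summable in n.  Modularity of cov A makes uniting an
    event of G n with B n nearly harmless, so the unions of B n, B n.+1, ...
    still have a covariance with A that is bounded away from 0, and so does
    their decreasing limit, the limit superior of B.  But this is a tail event,
    and a trivial event has covariance 0 with everything.

    Conversely, a tail event belongs to every G n, so if it decouples from the
    far past it is independent of itself (asymp_indep_trivial).

    Finally the events that decouple from the far past form a lambda-system
    (lambda_system_asymp_indep), and the cylinder sets are a pi-system that
    generates the whole sigma-algebra, so that decoupling extends from
    cylinder sets to all measurable sets. *)

(** * Covariance of two events *)

Section event_covariance.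
Context {d} {T : measurableType d} {R : realType} (P : probability T R).
Local Notation pr X := (fine (P X)).
Implicit Types A B C X : set T.
Local Open Scope ring_scope.

Definition event_cov A B : R := pr (A `&` B) - pr A * pr B.

Let prK A : measurable A -> (pr A)%:E = P A.
Proof. by move=> mA; rewrite fineK ?fin_num_measure. Qed.

Let pr_ge0 A : 0 <= pr A.
Proof. exact/fine_ge0/measure_ge0. Qed.

Let pr_le A B : measurable A -> measurable B -> A `<=` B -> pr A <= pr B.
Proof.
move=> mA mB AB; rewrite fine_le ?fin_num_measure//.
by rewrite le_measure// inE.
Qed.

Let pr_setT : pr [set: T] = 1.
Proof. by rewrite probability_setT. Qed.

Let pr_le1 A : measurable A -> pr A <= 1.
Proof. by move=> mA; rewrite -pr_setT; exact: pr_le. Qed.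

Let prD A B : measurable A -> measurable B -> B `<=` A ->
  pr (A `\` B) = pr A - pr B.
Proof.
move=> mA mB BA; rewrite measureD//; last by rewrite ltey_eq fin_num_measure.
rewrite setIidr// fineB ?fin_num_measure//.
Qed.

Let prU A B : measurable A -> measurable B ->
  pr (A `|` B) = pr A + pr B - pr (A `&` B).
Proof.
move=> mA mB; have mI : measurable (A `&` B) by exact: measurableI.
rewrite measureUfinl//; last by rewrite ltey_eq fin_num_measure.
by rewrite fineB ?fineD ?fin_numD ?fin_num_measure.
Qed.

Lemma abs_event_covE A B : measurable A -> measurable B ->
  (`|P (A `&` B) - P A * P B| = `|event_cov A B|%:E)%E.
Proof.
move=> mA mB; have mI : measurable (A `&` B) by exact: measurableI.
by rewrite -(prK mI) -(prK mA) -(prK mB) -EFinM -EFinB.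
Qed.

Lemma event_covC A B : event_cov A B = event_cov B A.
Proof. by rewrite /event_cov setIC mulrC. Qed.

Lemma event_covT A : event_cov A setT = 0.
Proof. by rewrite /event_cov setIT pr_setT mulr1 subrr. Qed.

Lemma event_covD A B C : measurable A -> measurable B -> measurable C ->
  C `<=` B -> event_cov A (B `\` C) = event_cov A B - event_cov A C.
Proof.
move=> mA mB mC CB; rewrite /event_cov setIDA.
have -> : A `&` B `\` C = (A `&` B) `\` (A `&` C).
  by apply/seteqP; split=> x /=; tauto.
rewrite !prD//; [ring|exact: measurableI|exact: measurableI|exact: setIS].
Qed.

(** Modularity: as a set function of one argument, event_cov is additive. *)
Lemma event_covU A B C : measurable A -> measurable B -> measurable C ->
  event_cov A (B `|` C) = event_cov A B + event_cov A C - event_cov A (B `&` C).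
Proof.
move=> mA mB mC; rewrite /event_cov setIUr !prU//; last 2 first.
- exact: measurableI.
- exact: measurableI.
rewrite setIACA setIid; ring.
Qed.

Lemma event_covCr A B : measurable A -> measurable B ->
  event_cov A (~` B) = - event_cov A B.
Proof. by move=> mA mB; rewrite -setTD event_covD// event_covT sub0r. Qed.

(** The bound is uniform in B: an event of small probability is almost
    independent of every event at once. *)
Lemma normr_event_cov_le A B : measurable A -> measurable B ->
  `|event_cov A B| <= pr A.
Proof.
move=> mA mB; rewrite /event_cov.
have mI : measurable (A `&` B) by exact: measurableI.
have := pr_ge0 (A `&` B); have := pr_le mI mA (@subIsetl _ A B).
have : 0 <= pr A * pr B by rewrite mulr_ge0.
have : pr A * pr B <= pr A by rewrite ler_piMr ?pr_le1.
by move=> *; rewrite ler_norml; lra.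
Qed.

Lemma event_cov_trivial A B : measurable A -> measurable B ->
  P B = 0%E \/ P B = 1%E -> event_cov A B = 0.
Proof.
move=> mA mB; have cov0 C : measurable C -> pr C = 0 -> event_cov A C = 0.
  move=> mC C0; apply/eqP; rewrite -normr_le0 -C0 event_covC.
  exact: normr_event_cov_le.
case=> PB; first by apply: cov0; rewrite ?PB.
apply/eqP; rewrite -oppr_eq0 -event_covCr// cov0//; first exact: measurableC.
by rewrite -setTD prD// pr_setT PB subrr.
Qed.

Lemma event_cov_self A : measurable A -> event_cov A A = 0 ->
  P A = 0%E \/ P A = 1%E.
Proof.
move=> mA /eqP; rewrite /event_cov setIid -{1}[pr A]mulr1 -mulrBr mulf_eq0.
rewrite subr_eq0 => /orP[/eqP A0|/eqP A1]; [left|right];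
  by rewrite -(prK mA) ?A0 -?A1.
Qed.

Lemma cvg_fine_probability_bigcup (F : (set T)^nat) :
  (forall n, measurable (F n)) -> nondecreasing_seq F ->
  pr (F n) @[n --> \oo] --> pr (\bigcup_n F n).
Proof.
move=> mF ndF; have mU : measurable (\bigcup_n F n) by exact: bigcup_measurable.
by apply: fine_cvg; rewrite fineK ?fin_num_measure//; exact: nondecreasing_cvg_mu.
Qed.

Lemma event_cov_bigcup A (F : (set T)^nat) : measurable A ->
  (forall n, measurable (F n)) -> nondecreasing_seq F ->
  event_cov A (F n) @[n --> \oo] --> event_cov A (\bigcup_n F n).
Proof.
move=> mA mF ndF.
apply: cvgB; last by apply: cvgMr; exact: cvg_fine_probability_bigcup.
rewrite setI_bigcupr; apply: cvg_fine_probability_bigcup => [n|m n mn].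
  exact: measurableI.
by apply/subsetPset; apply: setIS; apply/subsetPset; exact: ndF.
Qed.

Lemma event_cov_bigcap A (F : (set T)^nat) : measurable A ->
  (forall n, measurable (F n)) -> nonincreasing_seq F ->
  event_cov A (F n) @[n --> \oo] --> event_cov A (\bigcap_n F n).
Proof.
move=> mA mF niF; have mI : measurable (\bigcap_n F n) by exact: bigcapT_measurable.
rewrite -[event_cov A (\bigcap_n _)]opprK -event_covCr// setC_bigcap.
under eq_fun do rewrite -[event_cov A _]opprK -event_covCr//.
apply: cvgN; apply: event_cov_bigcup => // [n|m n mn]; first exact: measurableC.
by apply/subsetPset; apply: subsetC; apply/subsetPset; exact: niF.
Qed.

End event_covariance.

(** * Events that decouple from a sequence of set systems *)

Section asymptotic_independence.
Context {d} {T : measurableType d} {R : realType} (P : probability T R).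
Variable G : nat -> set (set T).
Hypothesis Gmeas : forall n, G n `<=` measurable.
Implicit Types A B C X : set T.
Local Open Scope ring_scope.
Local Notation cov := (event_cov P).

Definition asymp_indep A : Prop :=
  forall e : R, 0 < e -> exists n, forall B, G n B -> `|cov A B| <= e.

(** The event A is one of the events B that it decouples from, so it is
    independent of itself: its probability p satisfies p = p ^+ 2. *)
Lemma asymp_indep_trivial A : measurable A -> (forall n, G n A) ->
  asymp_indep A -> P A = 0%E \/ P A = 1%E.
Proof.
move=> mA GA indA; apply: event_cov_self => //; apply/eqP.
rewrite -normr_le0; apply/ler_addgt0Pr => e e0; rewrite add0r.
by have [n] := indA e e0; apply.
Qed.

(** For increasing unions, the event left out by F k has small probability,
    hence small covariance with all B simultaneously; the uniformity in B is
    what lets the property pass to the limit. *)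
Lemma lambda_system_asymp_indep : (forall m n, (m <= n)%N -> G n `<=` G m) ->
  lambda_system setT [set A | measurable A /\ asymp_indep A].
Proof.
move=> Gnoninc; split => //.
- split=> // e e0; exists 0%N => B _.
  by rewrite event_covC event_covT normr0 ltW.
- move=> A B BA [mA indA] [mB indB]; split; first exact: measurableD.
  move=> e e0; have e20 : 0 < e / 2 by rewrite divr_gt0.
  have [n nP] := indA _ e20; have [m mP] := indB _ e20.
  exists (maxn m n) => C GC; have mC := Gmeas GC.
  have /nP := Gnoninc _ _ (leq_maxr m n) _ GC.
  have /mP := Gnoninc _ _ (leq_maxl m n) _ GC.
  rewrite [cov (_ `\` _) _]event_covC event_covD// ![cov C _]event_covC.
  by have := ler_normB (cov A C) (cov B C); lra.
- move=> F ndF indF; have mF n : measurable (F n) by case: (indF n).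
  have mU : measurable (\bigcup_n F n) by exact: bigcup_measurable.
  split=> // e e0; have e20 : 0 < e / 2 by rewrite divr_gt0.
  have pF : fine (P (F n)) @[n --> \oo] --> fine (P (\bigcup_n F n)).
    exact: cvg_fine_probability_bigcup.
  have [k _ /(_ k (leqnn k)) kP] := (cvgrPdist_le _ _).1 pF _ e20.
  have [n nP] := (indF k).2 _ e20; exists n => B GB; have mB := Gmeas GB.
  have FkU : F k `<=` \bigcup_n F n by exact: bigcup_sup.
  have := nP B GB; have mD : measurable (\bigcup_n F n `\` F k).
    exact: measurableD.
  have := normr_event_cov_le P mD mB.
  rewrite measureD//; last by rewrite ltey_eq fin_num_measure.
  rewrite setIidr// fineB ?fin_num_measure//.
  rewrite [cov (_ `\` _) _]event_covC event_covD// ![cov B _]event_covC.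
  have := ler_norm (fine (P (\bigcup_n F n)) - fine (P (F k))).
  have := ler_normD (cov (\bigcup_n F n) B - cov (F k) B) (cov (F k) B).
  by rewrite subrK; move: kP => /=; lra.
Qed.

End asymptotic_independence.

(** * Triviality of the tail implies asymptotic independence *)

Section trivial_tail.
Context {d} {T : measurableType d} {R : realType} (P : probability T R).
Variable G : nat -> set (set T).
Hypothesis Gsigma : forall n, sigma_algebra setT (G n).
Hypothesis Gnoninc : forall m n, (m <= n)%N -> G n `<=` G m.
Hypothesis Gmeas : forall n, G n `<=` measurable.
Implicit Types A B C X : set T.
Local Open Scope ring_scope.
Local Notation cov := (event_cov P).

Let G0 n : G n set0.
Proof. by case: (Gsigma n). Qed.

Let GC n A : G n A -> G n (~` A).
Proof. by case: (Gsigma n) => _ + _ => /[apply]; rewrite setTD. Qed.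

Let Gbigcup n (D : set nat) (F : (set T)^nat) :
  (forall k, D k -> G n (F k)) -> G n (\bigcup_(k in D) F k).
Proof.
case: (Gsigma n) => _ _ Gcup GF; rewrite bigcup_mkcond; apply: Gcup => k.
by case: ifPn => [/set_mem/GF//|_]; exact: G0.
Qed.

Let GU n A B : G n A -> G n B -> G n (A `|` B).
Proof.
by move=> GA GB; rewrite -bigcup2E; apply: Gbigcup => -[|[|k]] _ //=; exact: G0.
Qed.

Let GI n A B : G n A -> G n B -> G n (A `&` B).
Proof.
by move=> GA GB; rewrite -[A `&` B]setCK setCI; apply/GC/GU; exact: GC.
Qed.

(** The limit superior does not change when the first n terms are dropped, and
    the others all lie in G n. *)
Lemma tail_lim_sup_set (B : (set T)^nat) : (forall n, G n (B n)) ->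
  forall n, G n (lim_sup_set B).
Proof.
move=> GB n; rewrite -[lim_sup_set B]setCK; apply: GC.
rewrite setC_bigcap.
have -> : \bigcup_m ~` (\bigcup_(j >= m) B j) =
    \bigcup_(m >= n) ~` (\bigcup_(j >= m) B j).
  apply/seteqP; split=> [x [m _ Bx]|x [m _ Bx]]; last by exists m.
  exists (maxn m n); first exact: leq_maxr.
  apply: contra_not Bx => -[j /= jm Bj]; exists j => //=; lia.
apply: Gbigcup => m /= nm; apply/GC/Gbigcup => j /= mj.
by apply: (Gnoninc (leq_trans nm mj)).
Qed.

Lemma almost_maximizer A n (e : R) : measurable A -> 0 < e ->
  exists2 B, G n B & forall C, G n C -> cov A C <= cov A B + e.
Proof.
move=> mA e0; pose E := [set cov A B | B in G n].
have supE : has_sup E.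
  split; first by exists (cov A set0), set0.
  exists (fine (P A)) => _ [B GB <-].
  by rewrite (le_trans (ler_norm _))// normr_event_cov_le//; exact: Gmeas GB.
have [_ [B GB <-] ltB] := sup_adherent e0 supE; exists B => // C GC'.
have : cov A C <= sup E by apply: sup_upper_bound => //; exists C.
by lra.
Qed.

(** Adjoining an almost maximizer B to an event C costs at most e: by modularity
    the gain is cov A B - cov A (B `&` C), and B `&` C competes with B. *)
Lemma event_covU_ge A B C n (e : R) : measurable A -> G n B -> G n C ->
  (forall D, G n D -> cov A D <= cov A B + e) ->
  cov A C - e <= cov A (B `|` C).
Proof.
move=> mA GB GC' maxB; rewrite event_covU//; try exact: (@Gmeas n).
by have := maxB _ (GI GB GC'); lra.
Qed.

(** The unions are built downwards, from B (n + j) to B n, each step adjoining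
    an almost maximizer on the current, larger sigma-algebra.  In the other
    order, event_covU_ge would not apply with the error of the new event. *)
Lemma event_cov_lim_sup_set_ge A (B : (set T)^nat) (e : R) :
  measurable A -> 0 < e -> (forall n, G n (B n)) ->
  (forall n C, G n C -> cov A C <= cov A (B n) + e / 2 ^+ n.+2) ->
  (forall n, e <= cov A (B n)) ->
  e / 2 <= cov A (lim_sup_set B).
Proof.
move=> mA e0 GB maxB geB.
pose U n j := \bigcup_(k in [set k | (n <= k <= n + j)%N]) B k.
have US n j : U n j.+1 = B n `|` U n.+1 j.
  apply/seteqP; split=> [x [k /= kn Bx]|x [Bx|[k /= kn Bx]]].
  - have [<-|nk] := eqVneq k n; [by left|right; exists k => //=; lia].
  - by exists n => //=; lia.
  - by exists k => //=; lia.
have GU' n j : G n (U n j).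
  by apply: Gbigcup => k /= /andP[nk _]; exact: Gnoninc nk _ (GB k).
have d0 n : 0 < e / 2 ^+ n by rewrite divr_gt0// exprn_gt0.
have dS n : e / 2 ^+ n = 2 * (e / 2 ^+ n.+1).
  by rewrite exprS; field; rewrite expf_neq0.
(* The errors e / 2 ^+ k.+2 for k >= n add up to e / 2 ^+ n.+1. *)
have geU j n : e - e / 2 ^+ n.+1 <= cov A (U n j).
  elim: j n => [n|j IHj n].
    have -> : U n 0%N = B n.
      rewrite /U addn0; apply/seteqP; split=> [x [k /= kn]|x Bx].
        by have -> : k = n by lia.
      by exists n => //=; rewrite leqnn.
    by have := geB n; have := d0 n.+1; lra.
  rewrite US.
  have := event_covU_ge mA (GB n) (Gnoninc (leqnSn n) (GU' n.+1 j)) (maxB n).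
  by have := IHj n.+1; have := dS n.+1; lra.
have geU2 j n : e / 2 <= cov A (U n j).
  have := geU j n; have : e / 2 ^+ n.+1 <= e / 2; last by lra.
  by rewrite ler_pM2l// lef_pV2 ?posrE ?exprn_gt0// ler_eXnr// ler1n.
have cupU n : \bigcup_j U n j = \bigcup_(k >= n) B k.
  apply/seteqP; split=> [x [j _ [k /= /andP[nk _] Bx]]|x [k /= nk Bx]].
    by exists k.
  by exists k => //; exists k => //=; lia.
have gecup n : e / 2 <= cov A (\bigcup_(k >= n) B k).
  rewrite -cupU.
  have cvgU : cov A (U n j) @[j --> \oo] --> cov A (\bigcup_j U n j).
    apply: event_cov_bigcup => // [j|i j ij]; first exact: (@Gmeas n).
    apply/subsetPset => x [k /= kn Bx]; exists k => //=; lia.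
  by apply: (cvgr_to_ge cvgU); exact: nearW (geU2^~ n).
have cvgT : cov A (\bigcup_(k >= n) B k) @[n --> \oo] --> cov A (lim_sup_set B).
  apply: event_cov_bigcap => // [n|m n mn].
    by rewrite -cupU; apply: bigcup_measurable => j _; exact: (@Gmeas n).
  by apply/subsetPset => x [k /= nk Bx]; exists k => //=; lia.
by apply: (cvgr_to_ge cvgT); exact: nearW gecup.
Qed.

(** The limit superior of almost maximizers is a tail event whose covariance
    with A would be positive if A did not decouple. *)
Lemma asymp_indep_of_trivial_tail :
  (forall B, (forall n, G n B) -> P B = 0%E \/ P B = 1%E) ->
  forall A, measurable A -> asymp_indep P G A.
Proof.
move=> trivG A mA e e0; apply: contrapT => Hn.
have big n : exists2 C, G n C & e < cov A C.
  have /existsNP[C /not_implyP[GC' /negP]] := (forallNP _).2 Hn n.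
  rewrite -ltNge lter_normr => /orP[ltC|ltC]; first by exists C.
  exists (~` C); first exact: GC.
  by rewrite event_covCr//; exact: Gmeas GC'.
(* Halving e makes room for the error in the choice of B n, so that B n itself
   has covariance at least e / 2 with A. *)
have e20 : 0 < e / 2 by rewrite divr_gt0.
have d0 n : 0 < e / 2 / 2 ^+ n.+2 by rewrite divr_gt0// exprn_gt0.
have /choice[B BP] n :
    exists B, G n B /\ forall C, G n C -> cov A C <= cov A B + e / 2 / 2 ^+ n.+2.
  by have [B GB maxB] := almost_maximizer n mA (d0 n); exists B.
have GB n : G n (B n) by case: (BP n).
have GT := tail_lim_sup_set GB.
have mT : measurable (lim_sup_set B) := Gmeas (GT 0%N).
have := event_cov_trivial mA mT (trivG _ GT).
have := event_cov_lim_sup_set_ge mA e20 GB (fun n => (BP n).2).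
move=> /[swap] -> geT.
have /geT : forall n, e / 2 <= cov A (B n); last by lra.
move=> n; have [C GC' ltC] := big n; have := (BP n).2 _ GC'.
have : e / 2 / 2 ^+ n.+2 <= e / 2; last by lra.
by rewrite ler_pdivrMr ?exprn_gt0// ler_peMr ?(ltW e20)// exprn_ege1// ler1n.
Qed.

End trivial_tail.

(** * Pasts, tail and cylinder sets of the configuration space *)

Section configurations.
Context {d} {E : measurableType d} {Omega : set (int -> E)}.
Variable Omega0 : Omega !=set0.
Local Notation config := (config Omega0).
Local Notation coord_sigma := (@coord_sigma_algebra d E Omega Omega0).

Definition past_sigma_algebra (n : nat) : set (set config) :=
  coord_sigma `]-oo, (- n%:Z)%R]%classic.

Lemma sigma_algebra_coord L : sigma_algebra setT (coord_sigma L).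
Proof. exact: smallest_sigma_algebra. Qed.

Lemma coord_sigma_algebraS L M : L `<=` M -> coord_sigma L `<=` coord_sigma M.
Proof.
move=> LM; apply: smallest_sub; first exact: smallest_sigma_algebra.
apply: subset_trans (@sub_sigma_algebra _ _ _); exact: bigcup_subset.
Qed.

Lemma past_sigma_algebra_noninc m n : (m <= n)%N ->
  past_sigma_algebra n `<=` past_sigma_algebra m.
Proof.
move=> mn; apply: coord_sigma_algebraS => i /=; rewrite !in_itv/=; lia.
Qed.

Lemma tail_sigma_algebraP A :
  tail_sigma_algebra Omega0 A <-> forall n, past_sigma_algebra n A.
Proof.
split=> [tA n|pA k _]; first exact: tA.
apply: coord_sigma_algebraS (pA `|k|%N) => i /=; rewrite !in_itv/=; lia.
Qed.

Lemma cylinder_setI_closed : setI_closed (@cylinder_set d E Omega Omega0).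
Proof.
move=> A B [p Fp pA] [q Fq qB].
exists (Order.min p.1 q.1, Order.max p.2 q.2).
  by rewrite /finite_itv /= ge_min le_max Fp.
set L := itv_set _.
have LA : coord_sigma L A.
  apply: coord_sigma_algebraS pA => i; rewrite /L /itv_set /= !in_itv/=.
  by rewrite ge_min le_max => /andP[-> ->].
have LB : coord_sigma L B.
  apply: coord_sigma_algebraS qB => i; rewrite /L /itv_set /= !in_itv/=.
  by rewrite ge_min le_max => /andP[-> ->]; rewrite !orbT.
have [//|_ _ _ LI] := (sigma_algebraP _).1 (sigma_algebra_coord L).
exact: LI.
Qed.

Lemma cylinder_set_measurable A : cylinder_set A -> measurable (A : set config).
Proof. by case=> p _; exact: coord_sigma_algebra_measurable. Qed.

(** Each coordinate event is a cylinder over a one-point interval. *)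
Lemma measurable_cylinder_generated :
  measurable `<=` <<s @cylinder_set d E Omega Omega0 >>.
Proof.
move=> _ [B mB <-].
suff : @product_sigma_algebra d E `<=`
    image_set_system setT (fun w : config => sval w)
      <<s @cylinder_set d E Omega Omega0 >> by exact.
apply: smallest_sub.
  exact/sigma_algebra_image/smallest_sigma_algebra.
move=> _ [i _ [C mC <-]]; rewrite /image_set_system /= !setTI.
apply: sub_sigma_algebra; exists (i, i) => /=; first exact: lexx.
apply: sub_sigma_algebra; exists i.
  by rewrite /itv_set /= in_itv/= lexx.
by exists C => //; rewrite setTI.
Qed.

Context {R : realType} (mu : probability config R).

(** The supremum only depends on the left endpoint of the interval, and
    enlarging the interval shrinks the past; the one-point intervals {-n} are
    thus enough to test the limit. *)
Lemma past_dependence_cvg0P A : measurable A ->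
  (past_dependence mu A p @[p --> itv_net] --> 0) <->
  asymp_indep mu past_sigma_algebra A.
Proof.
move=> mA; split.
  move=> /fine_cvgP[fin cvg] e e0.
  have [p Fp pP] : \forall p \near itv_net, past_dependence mu A p <= e%:E.
    move/cvgr0Pnorm_le : cvg => /(_ e e0) cvg.
    near=> p; rewrite -(@fineK _ (past_dependence mu A p)); last by near: p.
    by rewrite lee_fin (le_trans (ler_norm _))//; near: p.
  exists `|p.1 - 1|%N => B pB.
  have pB' : coord_sigma (itv_past p) B.
    apply: coord_sigma_algebraS pB => i /=; rewrite /itv_past/= !in_itv/=; lia.
  have mB := coord_sigma_algebra_measurable pB'.
  rewrite -lee_fin -abs_event_covE//.
  apply: le_trans (pP p _); last by split.
  by apply: ereal_sup_ubound; exists B.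
move=> indA.
have dep_ge0 p : 0 <= past_dependence mu A p.
  apply: ereal_sup_ge; exists `|mu (A `&` set0) - mu A * mu set0|.
    by exists set0 => //; case: (sigma_algebra_coord (itv_past p)).
  exact: abse_ge0.
have dep_le (e : R) : (0 < e)%R ->
    \forall p \near itv_net, past_dependence mu A p <= e%:E.
  move=> /indA[n nP]; exists (- n%:Z, - n%:Z)%R => /=; first exact: lexx.
  move=> [a b] [/= Fp sub]; apply: ge_ereal_sup => _ [B pB <-].
  have mB := coord_sigma_algebra_measurable pB.
  rewrite abs_event_covE// lee_fin; apply: nP.
  apply: coord_sigma_algebraS pB => i; rewrite /itv_past/= !in_itv/=.
  have := sub (- n%:Z)%R; rewrite /itv_set/= !in_itv/= lexx => /(_ isT); lia.
apply/fine_cvgP; split.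
  near=> p; rewrite ge0_fin_numE//.
  by apply: (@le_lt_trans _ _ 1%:E); [near: p; exact: dep_le|exact: ltry].
apply/cvgr0Pnorm_le => e e0; near=> p.
have pe : past_dependence mu A p <= e%:E by near: p; exact: dep_le.
rewrite /= ger0_norm ?fine_ge0// -lee_fin fineK// ge0_fin_numE//.
exact: le_lt_trans pe (ltry _).
Unshelve. all: by end_near. Qed.

End configurations.

Theorem theorem3p7 (R : realType) (d : measure_display) (E : measurableType d)
    (Omega : set (int -> E)) (Omega0 : Omega !=set0)
    (mu : probability (config Omega0) R) :
  (trivial_on mu (tail_sigma_algebra Omega0) <->
   (forall A : set (config Omega0), cylinder_set A ->
      past_dependence mu A p @[p --> itv_net] --> 0))
  /\
  ((forall A : set (config Omega0), cylinder_set A ->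
      past_dependence mu A p @[p --> itv_net] --> 0) <->
   (forall A : set (config Omega0), measurable A ->
      past_dependence mu A p @[p --> itv_net] --> 0)).
Proof.
have Gmeas n : @past_sigma_algebra _ _ _ Omega0 n `<=` measurable.
  exact: coord_sigma_algebra_measurable.
have bc : (forall A : set (config Omega0), cylinder_set A ->
      past_dependence mu A p @[p --> itv_net] --> 0) ->
    forall A : set (config Omega0), measurable A ->
      past_dependence mu A p @[p --> itv_net] --> 0.
  move=> b A mA; apply/past_dependence_cvg0P => //.
  have lam := lambda_system_asymp_indep mu Gmeas
    (@past_sigma_algebra_noninc _ _ _ Omega0).
  have [] // := lambda_system_subset (@cylinder_setI_closed _ _ _ Omega0) lam _ _
    (measurable_cylinder_generated mA).
  move=> B cB; have mB := cylinder_set_measurable cB; split => //.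
  by apply/past_dependence_cvg0P => //; exact: b.
have cb : (forall A : set (config Omega0), measurable A ->
      past_dependence mu A p @[p --> itv_net] --> 0) ->
    forall A : set (config Omega0), cylinder_set A ->
      past_dependence mu A p @[p --> itv_net] --> 0.
  by move=> c A /cylinder_set_measurable; exact: c.
split; split=> //.
- move=> a; apply: cb => A mA; apply/past_dependence_cvg0P => //.
  apply: asymp_indep_of_trivial_tail mA => //.
  + by move=> n; exact: sigma_algebra_coord.
  + exact: past_sigma_algebra_noninc.
  + by move=> B /tail_sigma_algebraP; exact: a.
- move=> /bc c A /tail_sigma_algebraP pA; have mA := Gmeas 0%N _ (pA 0%N).
  apply: asymp_indep_trivial pA _ => //.
  by apply/past_dependence_cvg0P => //; exact: c.
Qed.
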